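(* Up to isomorphism of symplectic Lie algebras, the only non-abelian flat symplectic Lie algebra of dimension 4 is $(\mathbb{R}\times\mathfrak{h}_3,\omega_0)$, where $\mathbb{R}\times\mathfrak{h}_3$ has a basis $x_1,x_2,x_3,x_4$ whose only non-vanishing bracket (up to skew-symmetry) is $[x_1,x_2]=x_3$, and $\omega_0=x_1^*\wedge x_4^*+x_2^*\wedge x_3^*$.
   Context: A symplectic Lie algebra $(\mathfrak{g},\omega)$ is a finite-dimensional real Lie algebra $\mathfrak{g}$ with a non-degenerate skew-symmetric bilinear form $\omega$ such that $\omega([u,v],w)+\omega([v,w],u)+\omega([w,u],v)=0$ for all $u,v,w\in\mathfrak{g}$. Its associated product $\bullet$ is defined by $\omega(u\bullet v,w)=\frac13\big(\omega([u,v],w)+\omega([u,w],v)\big)$ for all $u,v,w$; put $\mathrm{L}_uv=u\bullet v$. $(\mathfrak{g},\omega)$ is called flat if $\mathrm{L}_{[u,v]}=\mathrm{L}_u\mathrm{L}_v-\mathrm{L}_v\mathrm{L}_u$ for all $u,v\in\mathfrak{g}$. An isomorphism of symplectic Lie algebras is a Lie algebra isomorphism preserving the symplectic forms. $(x_i^* )$ denotes the dual basis and $(\alpha\wedge\beta)(u,v)=\alpha(u)\beta(v)-\alpha(v)\beta(u)$. *)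

(* Defs.v *)
From HB Require Import structures.
From mathcomp Require Import all_boot all_order all_algebra.
From mathcomp Require Import boolp reals.
From mathcomp Require Import ring.

Set Implicit Arguments.
Unset Strict Implicit.
Unset Printing Implicit Defensive.

Import GRing.Theory Num.Theory.
Local Open Scope ring_scope.

Record lieAlgebra (R : realType) := LieAlgebra {
  lie_carrier :> vectType R;
  bracket : {bilinear lie_carrier -> lie_carrier -> lie_carrier};
  bracketxx : forall u, bracket u u = 0;
  jacobi : forall u v w,
    bracket u (bracket v w) + bracket v (bracket w u)
    + bracket w (bracket u v) = 0
}.
Arguments bracket {R} _.

Notation "[ 'lie' u , v ]" := (bracket _ u v)
  (at level 0, format "[ 'lie'  u ,  v ]") : ring_scope.

Definition lie_abelian (R : realType) (g : lieAlgebra R) :=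
  forall u v : g, [lie u, v] = 0.

Record symplecticLieAlgebra (R : realType) := SymplecticLieAlgebra {
  symp_lie :> lieAlgebra R;
  omega : {skew_symmetric symp_lie};
  omega_nondegenerate : nondegenerate omega;
  omega_closed : forall u v w : symp_lie,
    omega [lie u, v] w + omega [lie v, w] u + omega [lie w, u] v = 0
}.
Arguments omega {R} _.

Definition symp_isomorphic (R : realType) (g h : symplecticLieAlgebra R) :=
  exists f : {linear g -> h},
    [/\ bijective f,
        forall u v, f [lie u, v] = [lie f u, f v]
      & forall u v, omega h (f u) (f v) = omega g u v].

Section AssociatedProduct.
Variables (R : realType) (g : symplecticLieAlgebra R).
Implicit Types u v w z : g.

Lemma omegaP z : (forall w, omega g z w = 0) -> z = 0.
Proof.
move=> z0; apply/eqP; rewrite -memv0 -(eqP (omega_nondegenerate g)).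
by apply/mem_orthovP => w _; apply: z0.
Qed.

Lemma omega_represents (phi : {linear g -> R^o}) :
  exists z, forall w, omega g z w = phi w.
Proof.
pose F (z : g) : 'Hom(g, R^o) := linfun (omega g z : g -> R^o).
have FE z w : F z w = omega g z w by rewrite lfunE.
have Flin : linear F.
  move=> a y z; apply/lfunP => w; rewrite add_lfunE scale_lfunE.
  by rewrite !FE linearPl.
pose Fl : {linear g -> 'Hom(g, R^o)} :=
  HB.pack F (GRing.isLinear.Build R g 'Hom(g, R^o) _ F Flin).
pose G := linfun Fl.
have GE z w : G z w = omega g z w by rewrite lfunE /= FE.
have kerG : lker G == 0%VS.
  rewrite -subv0; apply/subvP => z; rewrite memv_ker memv0 => /eqP Gz0.
  by apply/eqP/omegaP => w; rewrite -GE Gz0 lfunE.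
have imG : limg G = fullv.
  apply/eqP; rewrite -(geq_leqif (dimv_leqif_eq (subvf _))).
  rewrite limg_dim_eq ?(eqP kerG) ?capv0//.
  by rewrite !dimvf /dim /= muln1.
have /memv_imgP [z _ Gz] : linfun phi \in limg G by rewrite imG memvf.
by exists z => w; rewrite -GE -Gz lfunE.
Qed.

Lemma ex_assoc_prod u v : exists z, forall w,
  omega g z w = 3^-1 * (omega g [lie u, v] w + omega g [lie u, w] v).
Proof.
pose F w : R^o := 3^-1 * (omega g [lie u, v] w + omega g [lie u, w] v).
have Flin : linear F.
  move=> a w w'; rewrite /F linearPr /= linearPr/= linearPl/=.
  by rewrite /GRing.scale /=; ring.
pose Fl : {linear g -> R^o} :=
  HB.pack F (GRing.isLinear.Build R g R^o _ F Flin).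
exact: (omega_represents Fl).
Qed.

Definition assoc_prod u v : g := sval (cid (ex_assoc_prod u v)).

Lemma assoc_prodE u v w : omega g (assoc_prod u v) w =
  3^-1 * (omega g [lie u, v] w + omega g [lie u, w] v).
Proof. exact: (svalP (cid (ex_assoc_prod u v))). Qed.

Definition leftmul u : g -> g := assoc_prod u.

Definition symp_flat := forall u v w,
  leftmul [lie u, v] w = leftmul u (leftmul v w) - leftmul v (leftmul u w).

End AssociatedProduct.

Section RxH3.
Variable R : realType.
Local Notation V := 'rV[R]_4.
Implicit Types u v w : V.

(* R x h_3 is realized on R^4, with (x_1, x_2, x_3, x_4) the canonical basis;
   x_i^* is then the i-th coordinate function. *)
Definition x1 : V := delta_mx 0 0.
Definition x2 : V := delta_mx 0 1.
Definition x3 : V := delta_mx 0 2.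
Definition x4 : V := delta_mx 0 3.

Definition x1s u : R := u 0 0.
Definition x2s u : R := u 0 1.
Definition x3s u : R := u 0 2.
Definition x4s u : R := u 0 3.

Fact rh3_coord u :
  u = x1s u *: x1 + x2s u *: x2 + x3s u *: x3 + x4s u *: x4.
Proof.
apply/rowP => i; rewrite !mxE /=.
case: i => -[|[|[|[|//]]]] lti;
  rewrite ?(mulr0, mulr1, addr0, add0r); congr (u _ _); exact/val_inj.
Qed.

Definition wedge (a b : V -> R) u v : R := a u * b v - a v * b u.

Definition rh3_bracket u v : V := wedge x1s x2s u v *: x3.

Definition rh3_omega u v : R := wedge x1s x4s u v + wedge x2s x3s u v.

Fact rh3_bracket_basis :
  [/\ rh3_bracket x1 x2 = x3, rh3_bracket x1 x3 = 0, rh3_bracket x1 x4 = 0,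
      rh3_bracket x2 x3 = 0 & rh3_bracket x2 x4 = 0] /\ rh3_bracket x3 x4 = 0.
Proof.
by split; [split|]; rewrite /rh3_bracket /wedge /x1s /x2s !mxE /=
  ?(mulr0, mulr1, subr0, scale0r, scale1r).
Qed.

Fact rh3_bracket_bilinear : bilinear_for
  (GRing.Scale.Law.clone _ _ *:%R _) (GRing.Scale.Law.clone _ _ *:%R _)
  rh3_bracket.
Proof.
by split=> u a v w; apply/rowP => i;
   rewrite /rh3_bracket /wedge /x1s /x2s !mxE; ring.
Qed.

HB.instance Definition _ := bilinear_isBilinear.Build R V V V _ _
  rh3_bracket rh3_bracket_bilinear.

Fact rh3_omega_bilinear : bilinear_for
  (GRing.Scale.Law.clone _ _ *%R _)
  (GRing.Scale.Law.clone _ _ (idfun \; *%R) _)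
  rh3_omega.
Proof.
by split=> u a v w; rewrite /rh3_omega /wedge /x1s /x2s /x3s /x4s !mxE /=; ring.
Qed.

HB.instance Definition _ := bilinear_isBilinear.Build R V V R _ _
  rh3_omega rh3_omega_bilinear.

Fact rh3_omega_skew u v :
  rh3_omega u v = (-1) ^+ true * idfun (rh3_omega v u).
Proof. by rewrite /rh3_omega /wedge expr1 /=; ring. Qed.

HB.instance Definition _ := isHermitianSesquilinear.Build R V true idfun
  rh3_omega rh3_omega_skew.

Fact rh3_bracketxx u : rh3_bracket u u = 0.
Proof. by rewrite /rh3_bracket /wedge subrr scale0r. Qed.

Fact rh3_jacobi u v w :
  rh3_bracket u (rh3_bracket v w) + rh3_bracket v (rh3_bracket w u)
  + rh3_bracket w (rh3_bracket u v) = 0.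
Proof.
by apply/rowP => i; rewrite /rh3_bracket /wedge /x1s /x2s !mxE /=; ring.
Qed.

Definition rh3_lie : lieAlgebra R := LieAlgebra rh3_bracketxx rh3_jacobi.

Fact rh3_omega_nondegenerate : nondegenerate rh3_omega.
Proof.
rewrite /nondegenerate -subv0; apply/subvP => u /mem_orthovP uo.
have {}uo v : rh3_omega u v = 0 by apply: uo; rewrite memvf.
rewrite memv0; apply/eqP/rowP => i; rewrite mxE.
have := uo x1; have := uo x2; have := uo x3; have := uo x4.
rewrite /rh3_omega /wedge /x1s /x2s /x3s /x4s !mxE /=.
rewrite !(mulr0, mulr1, mul0r, mul1r, addr0, add0r, subr0, sub0r).
move=> u0 u1 /eqP; rewrite oppr_eq0 => /eqP u2 /eqP.
rewrite oppr_eq0 => /eqP u3.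
case: i => -[|[|[|[|//]]]] lti;
  [rewrite -u0|rewrite -u1|rewrite -u2|rewrite -u3]; congr (u _ _);
  exact/val_inj.
Qed.

Fact rh3_omega_closed u v w :
  rh3_omega (rh3_bracket u v) w + rh3_omega (rh3_bracket v w) u
  + rh3_omega (rh3_bracket w u) v = 0.
Proof.
rewrite /rh3_omega /rh3_bracket /wedge /x1s /x2s /x3s /x4s !mxE /=.
by ring.
Qed.

Definition rh3 : symplecticLieAlgebra R :=
  @SymplecticLieAlgebra R rh3_lie rh3_omega
    rh3_omega_nondegenerate rh3_omega_closed.

End RxH3.

(* Main.v *)
Require Import Defs.
From HB Require Import structures.
From mathcomp Require Import all_boot all_order all_algebra reals.
From mathcomp Require Import boolp ring lra.

(* Write L_x and R_x for the left and right multiplications of the product.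
   The product is torsion free, the L_x are in sp(omega), and the adjoint of R_x
   for omega is R_x + L_x. Flatness paired with omega gives x • (x • x) = 0, and
   polarizing this identity, taking adjoints and using flatness again leads to
   L_x^3 = 0, in every dimension. In dimension 4 an element of sp(omega) with zero
   cube has zero square, so the L_x anticommute; since L_[x,y] = 2 L_x L_y must
   anticommute with L_z too, L_x L_y L_z = 0. Expanding v in the basis
   x, x • x, v • x, v • (x • x) shows L_v L_x x = 0, which forces L_x L_y = 0.
   The products u • v then span a central isotropic subspace, and for y with
   y • y <> 0 and x with omega(y, [x, y]) = 1 a Darboux basis is obtained from
   x, y, [x, y], -3 y • y by adding multiples of y to x and of y • y to y. *)

Import GRing.Theory Num.Theory.

Section FlatSymplectic.
Local Open Scope ring_scope.
Variables (R : realType) (g : symplecticLieAlgebra R).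
Implicit Types (k : R) (a b c d u v x y z t : g).

Local Notation ω := (omega g).
Local Notation "u • v" := (assoc_prod u v)
  (at level 38, right associativity, format "u  •  v") : ring_scope.

(** * Bilinear calculus for the form and the product *)

Lemma omegaC u v : ω u v = - ω v u.
Proof. by rewrite hermC expr1 mulN1r. Qed.

Lemma omegaxx u : ω u u = 0.
Proof. have := omegaC u u; lra. Qed.

Lemma omegaDl u v z : ω (u + v) z = ω u z + ω v z.
Proof. exact: linearDl. Qed.
Lemma omegaDr u v z : ω z (u + v) = ω z u + ω z v.
Proof. exact: linearDr. Qed.
Lemma omegaNl u z : ω (- u) z = - ω u z.
Proof. exact: linearNl. Qed.
Lemma omegaNr u z : ω z (- u) = - ω z u.
Proof. exact: linearNr. Qed.
Lemma omegaZl k u z : ω (k *: u) z = k * ω u z.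
Proof. by rewrite linearZl_LR. Qed.
Lemma omegaZr k u z : ω z (k *: u) = k * ω z u.
Proof. by rewrite linearZr_LR. Qed.
Lemma omega0l z : ω 0 z = 0. Proof. exact: linear0l. Qed.
Lemma omega0r z : ω z 0 = 0. Proof. exact: linear0r. Qed.

Definition omegaE := (omegaDl, omegaDr, omegaNl, omegaNr, omegaZl, omegaZr,
  omega0l, omega0r).

Lemma omega_inj u v : (forall z, ω u z = ω v z) -> u = v.
Proof.
move=> uv; apply/eqP; rewrite -subr_eq0; apply/eqP/omegaP => z.
by rewrite !omegaE uv subrr.
Qed.

Lemma assoc_prodDl u v z : (u + v) • z = u • z + v • z.
Proof.
by apply: omega_inj => t; rewrite omegaDl !assoc_prodE !linearDl; ring.
Qed.
Lemma assoc_prodDr u v z : z • (u + v) = z • u + z • v.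
Proof.
by apply: omega_inj => t; rewrite omegaDl !assoc_prodE !(linearDr, omegaDl); ring.
Qed.
Lemma assoc_prodZl k u z : (k *: u) • z = k *: u • z.
Proof.
apply: omega_inj => t.
by rewrite omegaZl !assoc_prodE !linearZl_LR /=; ring.
Qed.
Lemma assoc_prodZr k u z : z • (k *: u) = k *: z • u.
Proof.
apply: omega_inj => t.
by rewrite omegaZl !assoc_prodE !(linearZr_LR, omegaZl) /=; ring.
Qed.
Lemma assoc_prodNl u z : (- u) • z = - (u • z).
Proof. by rewrite -scaleN1r assoc_prodZl scaleN1r. Qed.
Lemma assoc_prodNr u z : z • (- u) = - (z • u).
Proof. by rewrite -scaleN1r assoc_prodZr scaleN1r. Qed.
Lemma assoc_prod0l z : 0 • z = 0.
Proof. by have := assoc_prodZl 0 0 z; rewrite !scale0r. Qed.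
Lemma assoc_prod0r z : z • 0 = 0.
Proof. by have := assoc_prodZr 0 0 z; rewrite !scale0r. Qed.

Definition apE := (assoc_prodDl, assoc_prodDr, assoc_prodZl, assoc_prodZr,
  assoc_prodNl, assoc_prodNr, assoc_prod0l, assoc_prod0r).

Lemma lieC u v : [lie u, v] = - [lie v, u].
Proof.
apply/eqP; rewrite -addr_eq0; have := bracketxx (u + v).
by rewrite linearDl !linearDr !bracketxx /= add0r addr0 => ->.
Qed.

(** * Identities of the product on any symplectic Lie algebra *)

Lemma assoc_prod_sym u v z : ω (u • v) z = ω (u • z) v.
Proof. by rewrite !assoc_prodE addrC. Qed.

Lemma assoc_prod_skew u v z : ω (u • v) z = - ω v (u • z).
Proof. by rewrite assoc_prod_sym omegaC. Qed.

Lemma assoc_prod_cyclic u v z : ω (u • v) z + ω (v • z) u + ω (z • u) v = 0.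
Proof.
rewrite !assoc_prodE (lieC u z) (lieC v u) (lieC z v) !omegaE.
by have := omega_closed u v z; lra.
Qed.

Lemma assoc_prod_torsion u v : [lie u, v] = u • v - v • u.
Proof.
apply: omega_inj => z; rewrite !omegaE !assoc_prodE.
by have := omega_closed u v z; rewrite (lieC z u) (lieC v u) !omegaE; lra.
Qed.

Lemma assoc_prod_adj x u v : ω (u • x) v = ω u (v • x + x • v).
Proof.
have := assoc_prod_cyclic u x v.
by rewrite omegaDr (omegaC u (v • x)) (omegaC u (x • v)) (assoc_prod_sym v u); lra.
Qed.

(** * Consequences of flatness in every dimension *)

Hypothesis flat : symp_flat g.

Lemma flatE u v z : (u • v) • z - (v • u) • z = u • v • z - v • u • z.
Proof.
have := flat u v z; rewrite /leftmul assoc_prod_torsion.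
by rewrite assoc_prodDl assoc_prodNl.
Qed.

(** Flatness for [x], [v] is applied to [x] and paired with [x]: the terms [ω (v • x) (x • x)]
    cancel and [ω (x • v) (x • x) = 0] remains. *)
Lemma cube0 x : x • x • x = 0.
Proof.
apply: omega_inj => v; rewrite omega0l assoc_prod_skew.
have := congr1 (fun t => ω t x) (flatE x v x); rewrite !omegaE.
rewrite !(assoc_prod_adj x _ x) !(assoc_prod_skew _ (_ • _)) !omegaE.
by rewrite (omegaC (v • x)) (omegaC (x • v)); lra.
Qed.

Lemma cube_polarized x y z : x • y • z + x • z • y + y • x • z + y • z • x
  + z • x • y + z • y • x = 0.
Proof.
apply: omega_inj => t.
have D v := congr1 (fun u => ω u t) (cube0 v).
(* Inclusion-exclusion over the partial sums isolates the trilinear part. *)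
have := (D (x + y + z), D (x + y), D (x + z), D (y + z), D x, D y, D z).
rewrite /= !(apE, omegaE); case; do 6![case]; lra.
Qed.

(** Adjoint, evaluated at [z], of [cube_polarized] as an operator in its third argument, by L_x^* =
    -L_x and R_x^* = R_x + L_x. *)
Lemma cube_polarized_adj x y z :
  z • x • y + z • y • x + (x • y) • z + (y • x) • z = (x • z) • y + (y • z) • x.
Proof.
apply: omega_inj => u.
have := congr1 (fun t => ω t z) (cube_polarized x y u).
have := assoc_prod_adj (x • y) u z; have := assoc_prod_adj (y • x) u z.
rewrite !omegaE.
rewrite (assoc_prod_skew x (u • y)) (assoc_prod_skew y (u • x)).
rewrite !(assoc_prod_adj _ u) !omegaE.
rewrite (assoc_prod_skew x (y • u)) (assoc_prod_skew y (x • u)).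
rewrite (assoc_prod_skew x u) (assoc_prod_skew y u).
rewrite !(omegaC u); lra.
Qed.

(** With s = [x • y + y • x], two instances of [cube_polarized_adj] give [(y • x • x) • x] = (x • s)
    • x, while [cube_polarized] gives x • s = -(y • x • x); the vector equals its opposite. *)
Lemma rightmul_rightmul_sq x y : (y • x • x) • x = 0.
Proof.
apply: omega_inj => t.
have := congr1 (ω^~ t) (cube_polarized_adj x y (x • x)).
have := congr1 (ω^~ t) (cube_polarized_adj x x (x • y + y • x)).
have := congr1 (fun u => ω (u • x) t) (cube_polarized x x y).
rewrite /= !(apE, cube0, omegaE); lra.
Qed.

Lemma rightmul_sq x z : z • x • x = - (x • x • z) - x • z • x.
Proof.
apply: omega_inj => t; have := congr1 (ω^~ t) (cube_polarized x x z).
by rewrite /= !omegaE; lra.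
Qed.

Lemma leftmul_sq x z : (x • x) • z = (x • z) • x + x • x • z + x • z • x.
Proof.
apply: omega_inj => t; have := congr1 (ω^~ t) (cube_polarized_adj x x z).
by rewrite /= rightmul_sq !omegaE; lra.
Qed.

Lemma rightmul_twice x y :
  (y • x) • x = (x • y) • x - (x • y • x) *+ 2 - x • x • y.
Proof.
apply: omega_inj => t; have := congr1 (ω^~ t) (flatE x y x).
by rewrite /= rightmul_sq mulr2n !omegaE; lra.
Qed.

(** Flatness for [x] and [x • x], where [cube0] removes one term; the commutator of L_x with L_(x •
    x) is expanded by [leftmul_sq]. *)
Lemma leftmul_cube x y : ((x • x) • x) • y = (x • x • y) • x - x • x • y • x.
Proof.
apply: omega_inj => t; have := congr1 (ω^~ t) (flatE x (x • x) y).
by rewrite /= cube0 (leftmul_sq x y) (leftmul_sq x (x • y)) !(apE, omegaE); lra.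
Qed.

Lemma rightmul_cube x y :
  y • (x • x) • x = x • x • y • x - (x • (x • y) • x) *+ 3.
Proof.
apply: omega_inj => t.
have := congr1 (ω^~ t) (cube_polarized x (x • x) y).
have := congr1 (ω^~ t) (rightmul_rightmul_sq x y).
have := congr1 (fun u => ω (x • u) t) (rightmul_twice x y).
rewrite /= cube0 (leftmul_sq x y) (leftmul_sq x (x • y)) (leftmul_sq x (y • x)).
rewrite !rightmul_sq !mulrS !mulr0n.
by rewrite !(apE, omegaE); lra.
Qed.

(* For c = (x • x) • x, the identity R_c^* = R_c + L_c of assoc_prod_adj
   reduces to L_x^3 = 0. *)
Lemma leftmul_nil3 x y : x • x • x • y = 0.
Proof.
apply: omega_inj => z; rewrite omega0l.
have := assoc_prod_adj ((x • x) • x) y z.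
rewrite rightmul_cube leftmul_cube rightmul_cube !mulrS !mulr0n !omegaE.
have := assoc_prod_adj x y (x • x • z); have := assoc_prod_adj x (x • y) (x • z).
rewrite !omegaE !(assoc_prod_skew x _ z) (assoc_prod_skew x _ (x • z)).
rewrite !(assoc_prod_skew x y) (assoc_prod_skew x (x • y)) (assoc_prod_skew x y); lra.
Qed.

(** * Dimension 4: vanishing of products of left multiplications *)

Hypothesis dim4 : \dim {: g} = 4%N.

(** The Pfaffian of the Gram matrix reduces to [ω a d * ω b c], whatever [ω a b] and [ω a c] are. *)
Lemma frame_span a b c d : ω a d != 0 -> ω b c != 0 -> ω b d = 0 -> ω c d = 0 ->
  forall v, exists k : 'I_4 -> R,
    v = k 0 *: a + k 1 *: b + k 2 *: c + k 3 *: d.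
Proof.
move=> ad bc bd cd v; pose X := [tuple a; b; c; d].
suff /freeP freeX : forall k : 'I_4 -> R, \sum_(i < 4) k i *: X`_i = 0 ->
    forall i, k i = 0.
  have basisX : basis_of fullv X.
    by rewrite basisEfree freeX subvf dim4 size_tuple.
  exists (fun i => coord X i v).
  rewrite {1}(coord_basis basisX (memvf v)) !big_ord_recl big_ord0 addr0 !addrA.
  by congr (coord X _ v *: _ + coord X _ v *: _ + coord X _ v *: _
    + coord X _ v *: _); exact: val_inj.
move=> k; rewrite !big_ord_recl big_ord0 addr0 /= => sum0.
have eq0 u := congr1 (ω^~ u) sum0.
have := eq0 d; rewrite !omegaE bd cd omegaxx !mulr0 !addr0.
move=> /eqP; rewrite mulf_eq0 (negPf ad) orbF => /eqP k0.
have := eq0 b; rewrite k0 !omegaE omegaxx (omegaC d) bd oppr0 !mulr0 mul0r.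
rewrite !(addr0, add0r) (omegaC c).
move=> /eqP; rewrite mulf_eq0 oppr_eq0 (negPf bc) orbF => /eqP k2.
have := eq0 c; rewrite k0 k2 !omegaE (omegaC d) cd oppr0 !mulr0 !mul0r.
rewrite !(addr0, add0r).
move=> /eqP; rewrite mulf_eq0 (negPf bc) orbF => /eqP k1.
have := eq0 a; rewrite k0 k1 k2 !omegaE (omegaC d) !mul0r !add0r.
move=> /eqP; rewrite mulf_eq0 oppr_eq0 (negPf ad) orbF => /eqP k3.
by case=> -[|[|[|[|//]]]] lti;
  [rewrite -[RHS]k0|rewrite -[RHS]k1|rewrite -[RHS]k2|rewrite -[RHS]k3];
  congr k; exact: val_inj.
Qed.

Lemma omega_neq0 u : u <> 0 -> exists v, ω u v != 0.
Proof.
move=> u0; apply: contrapT => no; apply: u0; apply: omegaP => v.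
by apply: contrapT => /eqP uv; apply: no; exists v.
Qed.

(* Otherwise L_x^2, for which (y, b) |-> omega (L_x^2 y) b is alternating, would
   have rank at least 2, and L_x two Jordan blocks of size 3. *)
Lemma leftmul_nil2 x y : x • x • y = 0.
Proof.
apply: contrapT => /[dup] xxy0 /omega_neq0[b xxyb].
have xyxb : ω (x • y) (x • b) = - ω (x • x • y) b.
  by rewrite (assoc_prod_skew x (x • y)) opprK.
have [k] : exists k : 'I_4 -> R, y = k 0 *: b + k 1 *: (x • y) + k 2 *: (x • b)
    + k 3 *: (x • x • y).
  apply: frame_span.
  - by rewrite omegaC oppr_eq0.
  - by rewrite xyxb oppr_eq0.
  - by rewrite assoc_prod_skew leftmul_nil3 omega0r oppr0.
  - by rewrite assoc_prod_skew leftmul_nil3 omega0r oppr0.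
move=> /(congr1 (fun t => x • x • t)).
rewrite !apE !leftmul_nil3 apE !scaler0 !addr0 => xxyE.
have := congr1 (ω^~ y) xxyE; rewrite omegaZl.
rewrite (assoc_prod_skew x (x • y)) omegaxx oppr0.
rewrite assoc_prod_skew assoc_prod_skew opprK omegaC.
move=> /esym/eqP; rewrite mulf_eq0 oppr_eq0 (negPf xxyb) orbF => /eqP k0.
by apply: xxy0; rewrite xxyE k0 scale0r.
Qed.

Lemma leftmul_anticomm x y z : x • y • z = - (y • x • z).
Proof.
apply/eqP; rewrite -addr_eq0; have := leftmul_nil2 (x + y) z.
by rewrite !apE !leftmul_nil2 add0r addr0 addrC => ->.
Qed.

Lemma leftmul_lie x y z : [lie x, y] • z = (x • y • z) *+ 2.
Proof.
by rewrite assoc_prod_torsion !apE flatE (leftmul_anticomm y) opprK mulr2n.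
Qed.

(** Moving L_z past L_x and L_y one by one costs two signs, past L_[x,y] = 2 L_x L_y only one. *)
Lemma leftmul3 x y z t : x • y • z • t = 0.
Proof.
apply: omega_inj => s; rewrite omega0l.
have := congr1 (ω^~ s) (leftmul_anticomm [lie x, y] z t).
have := congr1 (fun u => ω (x • u) s) (leftmul_anticomm z y t).
have := congr1 (ω^~ s) (leftmul_anticomm z x (y • t)).
by rewrite /= !leftmul_lie !mulr2n !(apE, omegaE); lra.
Qed.

Lemma leftmul2_sym x y u v : ω (x • y • u) v = ω (x • y • v) u.
Proof.
rewrite assoc_prod_skew assoc_prod_skew opprK leftmul_anticomm omegaNr.
by rewrite -omegaC.
Qed.

Lemma leftmul_invariant_central c :
  (forall u, u • c = 0) -> forall u, c • u = 0.
Proof.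
move=> c0 u; apply: omega_inj => t; have := assoc_prod_cyclic c u t.
by rewrite (assoc_prod_sym u t c) !c0 !omega0l; lra.
Qed.

(* The symmetric form (z, t) |-> omega (x • y • z) t has rank at most 1: if it
   does not vanish at (b, b), then b, x • b, y • b, x • y • b is a basis whose last
   three vectors are in its kernel. *)
Lemma leftmul2_anisotropic x y z : ω (x • y • z) z = 0 -> x • y • z = 0.
Proof.
move=> zz0; apply: contrapT => xyz0; apply: (xyz0).
have [b bb] : exists b, ω (x • y • b) b != 0.
  apply: contrapT => no; apply: xyz0.
  have B0 b : ω (x • y • b) b = 0.
    by apply: contrapT => /eqP bb; apply: no; exists b.
  apply: omega_inj => t; have := B0 (z + t).
  by rewrite !(apE, omegaE) !B0 (leftmul2_sym x y t); lra.
have [k zE] : exists k : 'I_4 -> R, z = k 0 *: b + k 1 *: (x • b)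
    + k 2 *: (y • b) + k 3 *: (x • y • b).
  apply: frame_span.
  - by rewrite omegaC oppr_eq0.
  - by rewrite assoc_prod_skew oppr_eq0 omegaC oppr_eq0.
  - by rewrite assoc_prod_skew leftmul3 omega0r oppr0.
  - by rewrite assoc_prod_skew leftmul3 omega0r oppr0.
have xyzE : x • y • z = k 0 *: (x • y • b).
  by rewrite {1}zE !(apE, leftmul3, scaler0, addr0).
have : k 0 * (k 0 * ω (x • y • b) b) = 0.
  by rewrite -omegaZl -xyzE leftmul2_sym -omegaZl -xyzE.
move=> /eqP; rewrite mulrA !mulf_eq0 (negPf bb) orbF orbb => /eqP k0.
by rewrite xyzE k0 scale0r.
Qed.

(** With e = [v • x • x], the expansion gives [v • v] = k e and [x • v] = -l e, and the cyclic
    identity yields k ω(e, x) = 0. If ω(e, x) = 0, anisotropy applies; if k = 0, e is a multiple of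
    [(v • x) • x • x], where [v • x] is [[lie v, x]] up to a multiple of e, so [leftmul3]
    applies. *)
Lemma leftmul_leftmul_sq_aux x v k l m :
    v = k *: (x • x) + l *: (v • x) + m *: (v • x • x) ->
  v • x • x = 0.
Proof.
move=> vE; set e := v • x • x in vE *.
have e0l := leftmul_invariant_central e (fun u => leftmul3 u v x x).
have vv : v • v = k *: e by rewrite {2}vE !apE leftmul_nil2 leftmul3 !scaler0 !addr0.
have xv : x • v = - (l *: e).
  by rewrite {1}vE !apE leftmul_nil2 leftmul3 !scaler0 addr0 add0r
    leftmul_anticomm scalerN.
have := assoc_prod_cyclic x v v.
rewrite (assoc_prod_sym v x v) vv xv !omegaE.
have -> : ω e v = 0.
  by rewrite assoc_prod_skew vv omegaZr assoc_prod_skew leftmul3 !(omega0r, oppr0, mulr0).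
rewrite mulr0 oppr0 add0r => kex.
have /eqP : k * ω e x = 0 by lra.
rewrite mulf_eq0 => /orP[/eqP k0|/eqP/leftmul2_anisotropic //].
have mE : v • x = [lie v, x] - l *: e.
  by rewrite assoc_prod_torsion xv opprK addrK.
have eE : e = l *: ((v • x) • x • x).
  rewrite /e {1}vE k0 scale0r add0r !apE e0l scaler0 addr0.
  by [].
by rewrite eE mE !apE e0l leftmul_lie leftmul3 mul0rn !scaler0 subr0 scaler0.
Qed.

Lemma leftmul_leftmul_sq x v : v • x • x = 0.
Proof.
apply: contrapT => /[dup] e0 ne0.
have ex : ω (v • x • x) x != 0.
  by apply/eqP => /leftmul2_anisotropic.
have [k vE] : exists k : 'I_4 -> R, v = k 0 *: x + k 1 *: (x • x)
    + k 2 *: (v • x) + k 3 *: (v • x • x).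
  apply: frame_span.
  - by rewrite omegaC oppr_eq0.
  - by rewrite omegaC oppr_eq0 assoc_prod_skew oppr_eq0 omegaC oppr_eq0.
  - by rewrite assoc_prod_skew leftmul3 omega0r oppr0.
  - by rewrite assoc_prod_skew leftmul3 omega0r oppr0.
(* Removing the component of [v] along [x] preserves [v • x • x], but changes [v • x] by a multiple
   of [x • x], whence the coefficient [k 1 + k 2 * k 0]. *)
apply: e0; have <- : (v - k 0 *: x) • x • x = v • x • x.
  by rewrite !apE leftmul_nil2 scaler0 subr0.
apply: (@leftmul_leftmul_sq_aux _ _ (k 1 + k 2 * k 0) (k 2) (k 3)).
rewrite !apE leftmul_nil2 scaler0 subr0 {1}vE.
apply: omega_inj => t; rewrite !omegaE; ring.
Qed.

Lemma leftmul_anticommr x y z : x • y • z = - (x • z • y).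
Proof.
apply/eqP; rewrite -addr_eq0; have := leftmul_leftmul_sq (y + z) x.
by rewrite !apE !leftmul_leftmul_sq add0r addr0 addrC => ->.
Qed.

(* omega (x • y • z) t is alternating in x, y, z but symmetric in z, t. *)
Lemma leftmul2_0 x y z : x • y • z = 0.
Proof.
apply: omega_inj => t; rewrite omega0l.
have := leftmul2_sym x y z t.
have := congr1 (ω^~ z) (leftmul_anticommr x y t).
have := leftmul2_sym x t y z.
have := congr1 (ω^~ y) (leftmul_anticommr x t z).
have := leftmul2_sym x z t y.
have := congr1 (ω^~ t) (leftmul_anticommr x z y).
by rewrite /= !omegaE; lra.
Qed.

(** * Central products and a Darboux frame *)

Lemma assoc_prod_central x y u : [lie x • y, u] = 0.
Proof.
rewrite assoc_prod_torsion leftmul2_0 leftmul_invariant_central ?subr0//.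
by move=> t; exact: leftmul2_0.
Qed.

Lemma omega_assoc_prod x y u v : ω (x • y) (u • v) = 0.
Proof. by rewrite assoc_prod_skew leftmul2_0 omega0r oppr0. Qed.

Lemma omega_sq_self y : ω (y • y) y = 0.
Proof. by have := assoc_prod_cyclic y y y; lra. Qed.

Lemma omega_lie_sq x y : ω y [lie x, y] = 3 * ω (y • y) x.
Proof.
rewrite assoc_prod_torsion !omegaE (omegaC y) (omegaC y).
have := assoc_prod_cyclic x y y; rewrite (assoc_prod_sym y x y); lra.
Qed.

(** If all squares vanish, [ω (x • y) z] is skew in [x], [y] and symmetric in [y], [z], hence
    zero. *)
Lemma ex_sq_neq0 : ~ lie_abelian g -> exists y, y • y <> 0.
Proof.
move=> nab; apply: contrapT => no; apply: nab.
have sq0 y : y • y = 0 by apply: contrapT => yy; apply: no; exists y.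
have skew x y : x • y = - (y • x).
  apply/eqP; rewrite -addr_eq0; have := sq0 (x + y).
  by rewrite !apE !sq0 add0r addr0 addrC => ->.
suff prod0 x y : x • y = 0 by move=> x y; rewrite assoc_prod_torsion !prod0 subr0.
apply: omega_inj => z; rewrite omega0l.
have := congr1 (ω^~ z) (skew x y); have := congr1 (ω^~ x) (skew y z).
have := congr1 (ω^~ y) (skew z x); rewrite /= !omegaE.
by rewrite (assoc_prod_sym x y) (assoc_prod_sym y x) (assoc_prod_sym z x); lra.
Qed.

Lemma ex_darboux_frame : ~ lie_abelian g -> exists a b c d,
  [/\ ω a d = 1, ω b c = 1, ω a b = 0, ω a c = 0 & ω b d = 0] /\
  [/\ ω c d = 0, [lie a, b] = c, forall u, [lie c, u] = 0
    & forall u, [lie d, u] = 0].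
Proof.
move=> /ex_sq_neq0[y /omega_neq0[x0 yx0]].
have [x yxy] : exists x, ω y [lie x, y] = 1.
  exists ((3 * ω (y • y) x0)^-1 *: x0).
  by rewrite omega_lie_sq omegaZr; field.
move: {x0 yx0} yxy; set c := [lie x, y] => yc.
(* The shift along [y] makes [ω a c] vanish, as [ω y c = 1], and keeps the bracket with [y]. *)
pose a := x - ω x c *: y.
have ay : [lie a, y] = c.
  by rewrite linearBl linearZl_LR /= bracketxx scaler0 subr0.
(* The factor -3 normalizes [ω a d] to 1, by [omega_lie_sq]. *)
pose d := - 3 *: (y • y).
have d0 u : [lie d, u] = 0.
  by rewrite linearZl_LR /= assoc_prod_central scaler0.
have c0 u : [lie c, u] = 0.
  by rewrite /c (assoc_prod_torsion x y) linearBl /= !assoc_prod_central subr0.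
have cd : ω c d = 0.
  by rewrite /c (assoc_prod_torsion x y) !omegaE !omega_assoc_prod; ring.
have ac : ω a c = 0 by rewrite /a !omegaE yc mulr1 subrr.
have ad : ω a d = 1.
  by have := omega_lie_sq a y; rewrite ay yc /d omegaZr omegaC; lra.
have yd : ω y d = 0 by rewrite /d omegaZr omegaC omega_sq_self; ring.
clearbody d a c.
(* Since [ω a d = 1] and [d] is central, this correction of [y] kills [ω a b] without changing the
   bracket with [a]. *)
exists a, (y - ω a y *: d), c, d; split; split => //.
- by rewrite !omegaE yc (omegaC d) cd; ring.
- by rewrite !omegaE ad; ring.
- by rewrite !omegaE yd omegaxx; ring.
- by rewrite linearBr linearZr_LR /= ay (lieC a) d0 oppr0 scaler0 subr0.
Qed.

Lemma frame_decomposition a b c d :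
    [/\ ω a d = 1, ω b c = 1, ω a b = 0, ω a c = 0 & ω b d = 0] /\ ω c d = 0 ->
  forall u, u = ω u d *: a + ω u c *: b - ω u b *: c - ω u a *: d.
Proof.
move=> [[ad bc ab ac bd] cd] u.
have [k ->] : exists k : 'I_4 -> R,
    u = k 0 *: a + k 1 *: b + k 2 *: c + k 3 *: d.
  by apply: frame_span => //; rewrite ?ad ?bc oner_neq0.
apply: omega_inj => t; rewrite !omegaE.
rewrite (omegaC b a) (omegaC c a) (omegaC c b) (omegaC d a) (omegaC d b).
by rewrite (omegaC d c) !omegaxx ad bc ab ac bd cd; ring.
Qed.

End FlatSymplectic.

(** * The isomorphism with the model, and the properties of the model *)

Section Classification.
Local Open Scope ring_scope.
Variable R : realType.

Lemma symp_isomorphic_rh3 (g : symplecticLieAlgebra R) :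
  \dim {: g} = 4%N -> ~ lie_abelian g -> symp_flat g ->
  symp_isomorphic g (rh3 R).
Proof.
move=> dim4 nab flat.
have [a [b [c [d [abcd [cd abE c0 d0]]]]]] := ex_darboux_frame _ _ flat dim4 nab.
have decomp := frame_decomposition _ _ dim4 _ _ _ _ (conj abcd cd).
have [ad bc ab ac bd] := abcd.
(* The coordinates of [frame_decomposition], so that [a], [b], [c], [d] go to the canonical
   basis. *)
pose F (u : g) : rh3 R := omega g u d *: x1 R + omega g u c *: x2 R
  - omega g u b *: x3 R - omega g u a *: x4 R.
have Flin : linear F.
  move=> k u v; apply/rowP => i; rewrite !mxE /= !omegaE; ring.
pose f : {linear g -> rh3 R} :=
  HB.pack F (GRing.isLinear.Build R g (rh3 R) _ F Flin).
have fE u : f u = F u by [].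
have Fcoord u : [/\ x1s (F u) = omega g u d, x2s (F u) = omega g u c,
    x3s (F u) = - omega g u b & x4s (F u) = - omega g u a].
  by rewrite /x1s /x2s /x3s /x4s !mxE /=; split; ring.
pose sk := omegaC R g.
exists f; split.
- exists (fun r : rh3 R => x1s r *: a + x2s r *: b + x3s r *: c + x4s r *: d).
    move=> u; rewrite fE; have [-> -> -> ->] := Fcoord u.
    by rewrite [RHS]decomp !scaleNr.
  move=> r; rewrite fE [RHS]rh3_coord /F !omegaE !omegaxx.
  rewrite (sk b a) (sk c a) (sk c b) (sk d a) (sk d b) (sk d c) ad bc ab ac bd cd.
  by apply/rowP => i; rewrite !mxE /=; ring.
- have cr u : [lie u, c] = 0 by rewrite lieC c0 oppr0.
  have dr u : [lie u, d] = 0 by rewrite lieC d0 oppr0.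
  move=> u v; have -> : [lie u, v] =
      (omega g u d * omega g v c - omega g v d * omega g u c) *: c.
    rewrite {1}(decomp u) {1}(decomp v).
    rewrite !(linearBl, linearDl, linearZl_LR, linearBr, linearDr, linearZr_LR) /=.
    rewrite !(c0, d0, cr, dr, bracketxx) (lieC _ _ b a) abE.
    by apply: omega_inj => t; rewrite !omegaE; ring.
  rewrite linearZ_LR /= /rh3_bracket /wedge.
  have [-> -> _ _] := Fcoord u; have [-> -> _ _] := Fcoord v.
  congr (_ *: _); rewrite /F cd omegaxx (sk c b) (sk c a) bc ac.
  by rewrite oppr0 !scale0r scaleN1r add0r opprK subr0 add0r.
- move=> u v; rewrite /= /rh3_omega /wedge.
  have [-> -> -> ->] := Fcoord u; have [-> -> -> ->] := Fcoord v.
  rewrite [in RHS](decomp u) !omegaE (sk a v) (sk b v) (sk c v) (sk d v); ring.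
Qed.

Lemma rh3_dim : \dim {: rh3 R} = 4%N.
Proof. by rewrite dimvf /dim /= mul1n. Qed.

Lemma rh3_nonabelian : ~ lie_abelian (rh3 R).
Proof.
move=> /(_ (x1 R) (x2 R)) /=; have [[-> _ _ _ _] _] := rh3_bracket_basis R.
by move=> /(congr1 (@x3s R)); rewrite /x3s !mxE /= => /eqP; rewrite oner_eq0.
Qed.

(** The explicit product turns flatness of the model into a polynomial identity in coordinates. *)
Lemma rh3_assoc_prod (u v : rh3 R) : assoc_prod u v =
  ((2 * x1s u * x2s v - x2s u * x1s v) / 3) *: x3 R - (x2s u * x2s v / 3) *: x4 R.
Proof.
apply: omega_inj => t; rewrite assoc_prodE /=.
rewrite /rh3_omega /rh3_bracket /wedge /x1s /x2s /x3s /x4s !mxE /=.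
by field.
Qed.

Lemma rh3_flat : symp_flat (rh3 R).
Proof.
move=> u v t; rewrite /leftmul !rh3_assoc_prod /= /rh3_bracket /wedge.
by apply/rowP => i; rewrite /x1s /x2s /x3s /x4s !mxE /=; ring.
Qed.

End Classification.

Theorem proposition5p2 (R : realType) :
  [/\ \dim {: rh3 R} = 4, ~ lie_abelian (rh3 R) & symp_flat (rh3 R)] /\
  (forall g : symplecticLieAlgebra R,
     \dim {: g} = 4 -> ~ lie_abelian g -> symp_flat g ->
     symp_isomorphic g (rh3 R)).
Proof.
split; first by split; [exact: rh3_dim|exact: rh3_nonabelian|exact: rh3_flat].
exact: symp_isomorphic_rh3.
Qed.
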